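(* Let $(X,\mathcal A,\mathcal I)$ be a triple such that $\mathcal A\smallsetminus\mathcal I$ satisfies the countable chain condition and $X$ has the non-separation property with respect to $\mathcal A$. Then each infinite subset $E$ of $X$ decomposes into two disjoint full subsets, i.e. $E=E_1\cup E_2$ with $E_1\cap E_2=\emptyset$ and $E_1,E_2$ full subsets of $E$. Consequently, $E$ can be written as the union of an infinite family of pairwise disjoint subsets, each of which is a full subset of $E$ (equivalently, each of which is completely non-measurable in $E$).
   Context: A triple $(X,\mathcal A,\mathcal I)$ consists of a set $X$, a $\sigma$-algebra $\mathcal A$ of subsets of $X$ (called measurable sets) and a $\sigma$-ideal $\mathcal I$ of subsets of $X$ (called negligible sets) with $\mathcal I\subset\mathcal A$. For $E\subset Q\subset X$, $E$ is a full subset of $Q$ if for each $B\in\mathcal A$ with $E\subset B$ one has $Q\smallsetminus B\in\mathcal I$. A subset $E\subset Q$ is completely non-measurable in $Q$ if for each $A\in\mathcal A$ with $A\cap Q\notin\mathcal I$ one has $A\cap E\notin\mathcal I$ and $A\cap(Q\smallsetminus E)\notin\mathcal I$. Countable chain condition (CCC) for $\mathcal A\smallsetminus\mathcal I$: every disjoint family of non-negligible measurable sets is countable. Non-separation property of $X$ with respect to $\mathcal A$: for every $E\subset X$ with $E\notin\mathcal I$ there exist disjoint subsets $F,G$ of $E$ that cannot be separated by sets from $\mathcal A$, i.e. there is no $A\in\mathcal A$ with $F\subset A$ and $A\cap G=\emptyset$. *)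

(* Defs.v *)
From mathcomp Require Import all_boot.
From mathcomp Require Export all_classical.
From mathcomp Require Export measurable_structure.

Set Implicit Arguments.
Unset Strict Implicit.
Unset Printing Implicit Defensive.

Local Open Scope classical_set_scope.

Definition sigma_ideal (X : Type) (I : set (set X)) : Prop :=
  [/\ I set0,
      forall A B : set X, A `<=` B -> I B -> I A &
      forall A : nat -> set X, (forall n, I (A n)) -> I (\bigcup_n A n)].

Definition measurable_triple (X : Type) (A I : set (set X)) : Prop :=
  [/\ sigma_algebra setT A, sigma_ideal I & I `<=` A].

Definition full_subset (X : Type) (A I : set (set X)) (E Q : set X) : Prop :=
  E `<=` Q /\ forall B : set X, A B -> E `<=` B -> I (Q `\` B).

Definition completely_nonmeasurable (X : Type) (A I : set (set X))
    (E Q : set X) : Prop :=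
  E `<=` Q /\
  forall B : set X, A B -> ~ I (B `&` Q) ->
    ~ I (B `&` E) /\ ~ I (B `&` (Q `\` E)).

Definition countable_chain_condition (X : Type) (S : set (set X)) : Prop :=
  forall F : set (set X), F `<=` S -> trivIset F id -> countable F.

Definition separated_by (X : Type) (A : set (set X)) (F G : set X) : Prop :=
  exists B : set X, [/\ A B, F `<=` B & B `&` G = set0].

Definition non_separation_property (X : Type) (A I : set (set X)) : Prop :=
  forall E : set X, ~ I E ->
    exists F G : set X,
      [/\ F `<=` E, G `<=` E, F `&` G = set0 & ~ separated_by A F G].

(* The family is a set of sets, so its members are distinct; an indexed
   version could repeat the empty set infinitely often. *)
Definition infinite_decomposition (X : Type) (E : set X) (F : set (set X))
    : Prop :=
  [/\ infinite_set F, trivIset F id & \bigcup_(S in F) S = E].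

(* Main.v *)
(** By the chain condition every set is a full subset of some measurable set,
    its hull.  If [F] and [G] are disjoint and cannot be separated, the
    intersection [M] of their hulls is not negligible, and [F] and [G] induce
    disjoint full subsets of [M].  Hence every non-negligible set has a
    non-negligible measurable piece that splits into two full halves; a maximal
    disjoint family of such pieces is countable and exhausts the set up to a
    negligible remainder, so the halves can be glued.  As fullness is
    transitive, halving repeatedly gives infinitely many disjoint full
    subsets. *)
Require Import Defs.
From mathcomp Require Import all_boot all_classical.

Set Implicit Arguments.
Unset Strict Implicit.
Unset Printing Implicit Defensive.

Local Open Scope classical_set_scope.

Section CountableUnions.
Context {X : Type} (G : set (set X)).
Hypothesis G0 : G set0.
Hypothesis G_bigcup : forall B : nat -> set X,
  (forall n, G (B n)) -> G (\bigcup_n B n).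

Lemma countable_bigcup_closed {T : Type} (D : set T) (B : T -> set X) :
  countable D -> (forall i, D i -> G (B i)) -> G (\bigcup_(i in D) B i).
Proof.
move=> /pfcard_geP[->|[g]] GB; first by rewrite bigcup_set0.
rewrite -[D](image_eq g) bigcup_image; apply: G_bigcup => n.
exact/GB/funS.
Qed.

Lemma countable_setU_closed : setU_closed G.
Proof. by move=> B C GB GC; rewrite -bigcup2E; apply: G_bigcup => -[|[|n]]. Qed.

End CountableUnions.

Section Fibers.
Context {X : Type}.
Implicit Types E : set X.

Lemma infinite_set_fibers E : infinite_set E ->
  exists k : X -> nat, forall n, E `&` k @^-1` [set n] !=set0.
Proof.
move=> /infiniteP/pfcard_geP[/seteqP[/(_ 0%N Logic.I)//]|[k]].
by exists k => n; have [x Ex <-] := 'surj_k (Logic.I : [set: nat] n); exists x.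
Qed.

Lemma trivIset_sub_fibers (T : nat -> set X) : trivIset setT T ->
  exists k : X -> nat, forall n, T n `<=` k @^-1` [set n].
Proof.
move=> tT; suff /choice[k kE] : forall x, exists n, forall m, T m x -> n = m.
  by exists k => n x /kE.
move=> x; have [[n Tnx]|notT] := pselect (exists n, T n x).
  by exists n => m Tmx; apply: tT => //; exists x.
by exists 0%N => m Tmx; case: notT; exists m.
Qed.

Lemma infinite_decomposition_fibers E (k : X -> nat) :
  (forall n, E `&` k @^-1` [set n] !=set0) ->
  infinite_decomposition E (range (fun n => E `&` k @^-1` [set n])).
Proof.
move=> fiber_neq0; split.
- apply: contra_not infinite_nat; rewrite (eq_finite_set (inj_card_eq _))//.
  move=> m n _ _ eq_mn; have [x mx] := fiber_neq0 m.
  by have [_ <-] := mx; move: mx; rewrite eq_mn => -[_ ->].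
- exact/trivIset_image/trivIset_preimage1_in.
- rewrite bigcup_image -setI_bigcupr; apply/setIidPl => x _.
  by exists (k x).
Qed.

End Fibers.

Section FullSubsets.
Context {X : Type}.
Implicit Types (A I : set (set X)) (B C E S : set X).

Definition full_halvable A I E : Prop :=
  exists S, full_subset A I S E /\ full_subset A I (E `\` S) E.

Lemma full_subsetS A I S S' E :
  S `<=` S' -> S' `<=` E -> full_subset A I S E -> full_subset A I S' E.
Proof.
move=> SS' S'E [_ full]; split=> // B AB S'B.
by apply: full => //; exact: subset_trans S'B.
Qed.

End FullSubsets.

Section SigmaIdeal.
Context {X : Type} {I : set (set X)} (I_ideal : sigma_ideal I).
Implicit Types (A : set (set X)) (B C E S : set X).

Lemma negligible0 : I set0.
Proof. by case: I_ideal. Qed.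

Lemma sub_negligible B C : B `<=` C -> I C -> I B.
Proof. by case: I_ideal => _ + _; exact. Qed.

Lemma negligible_bigcup {T : Type} (D : set T) (B : T -> set X) :
  countable D -> (forall i, D i -> I (B i)) -> I (\bigcup_(i in D) B i).
Proof. by case: I_ideal => I0 _ IU; exact: countable_bigcup_closed. Qed.

Lemma negligibleU : setU_closed I.
Proof. by case: I_ideal => I0 _ IU; exact: countable_setU_closed. Qed.

Lemma full_subset_sub A S E E' :
  S `<=` E' -> E' `<=` E -> full_subset A I S E -> full_subset A I S E'.
Proof.
move=> SE' E'E [_ full]; split=> // B AB SB.
by apply: sub_negligible (full _ AB SB); exact: setSD.
Qed.

Lemma full_subset_mod_negligible A S E :
  S `<=` E -> I (E `\` S) -> full_subset A I S E.
Proof.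
by move=> SE IES; split=> // B _ SB; apply: sub_negligible IES; exact: setDS.
Qed.

Lemma full_subset_refl A E : full_subset A I E E.
Proof.
by apply: full_subset_mod_negligible; rewrite ?setDv//; exact: negligible0.
Qed.

End SigmaIdeal.

Section SigmaAlgebra.
Context {X : Type} {A : set (set X)} (A_sigma : sigma_algebra setT A).

Lemma sigma_algebra_setC : setC_closed A.
Proof. by case: A_sigma => _ AC _ B /AC; rewrite setTD. Qed.

Lemma sigma_algebra_setI : setI_closed A.
Proof. by case/sigma_algebraP: A_sigma. Qed.

Lemma sigma_algebra_setD : setD_closed A.
Proof. by case/sigma_algebraP: A_sigma => // _ ? _ ?; apply/setD_closedP. Qed.

Lemma sigma_algebra_countable_bigcup {T : Type} (D : set T) (B : T -> set X) :
  countable D -> (forall i, D i -> A (B i)) -> A (\bigcup_(i in D) B i).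
Proof. by case: A_sigma => A0 _ AU; exact: countable_bigcup_closed. Qed.

End SigmaAlgebra.

Section Triple.
Context {X : Type} {A I : set (set X)} (AI_triple : measurable_triple A I).
Implicit Types B C E F G H M S : set X.

Let A_sigma : sigma_algebra setT A. Proof. by case: AI_triple. Qed.

Let I_ideal : sigma_ideal I. Proof. by case: AI_triple. Qed.

Lemma negligible_measurable B : I B -> A B.
Proof. by case: AI_triple => _ _; exact. Qed.

Lemma setD_mod_negligible_measurable B S : A B -> I (B `&` S) -> A (B `\` S).
Proof.
move=> AB IBS; rewrite -[B `\` S]set0U -(setDv B) -setDIr.
by apply: sigma_algebra_setD => //; exact: negligible_measurable.
Qed.

Lemma full_subsetP S E : full_subset A I S E <->
  S `<=` E /\ forall B, A B -> I (B `&` S) -> I (B `&` E).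
Proof.
split=> -[SE full]; split=> // B AB.
- move=> IBS; have AC : A (~` (B `\` S)).
    exact/(sigma_algebra_setC A_sigma)/setD_mod_negligible_measurable.
  have SC : S `<=` ~` (B `\` S) by move=> x Sx [].
  have := negligibleU I_ideal IBS (full _ AC SC).
  apply: (sub_negligible I_ideal) => x [Bx Ex].
  by have [Sx|nSx] := pselect (S x); [left|right; split=> //; exact].
- move=> SB; rewrite setDE setIC; apply: full; first exact: sigma_algebra_setC.
  rewrite setIC (disjoints_subset _ _).2 ?setCK//; exact: negligible0.
Qed.

Lemma full_subset_trans S E F :
  full_subset A I F S -> full_subset A I S E -> full_subset A I F E.
Proof.
move=> /full_subsetP[FS fullF] /full_subsetP[SE fullS]; apply/full_subsetP.
split=> [|B AB /(fullF _ AB)]; last exact: fullS.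
exact: subset_trans SE.
Qed.

Lemma full_subset_setIr S E B :
  A B -> full_subset A I S E -> full_subset A I (S `&` B) (E `&` B).
Proof.
move=> AB /full_subsetP[SE full]; apply/full_subsetP; split; first exact: setSI.
move=> C AC; rewrite ![_ `&` B]setIC !setIA; apply: full.
exact: sigma_algebra_setI.
Qed.

Lemma full_subset_bigcup {T : Type} (D : set T) (S E : T -> set X) :
  countable D -> (forall i, D i -> full_subset A I (S i) (E i)) ->
  full_subset A I (\bigcup_(i in D) S i) (\bigcup_(i in D) E i).
Proof.
move=> cD full; apply/full_subsetP; split.
  by apply: subset_bigcup => i /full[].
move=> B AB IBS; rewrite setI_bigcupr; apply: negligible_bigcup => // i Di.
have /full_subsetP[_ full_i] := full i Di.
apply: full_i => //; apply: (sub_negligible I_ideal) IBS.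
by apply: setIS; exact: bigcup_sup.
Qed.

Lemma full_subset_neq0 S E : full_subset A I S E -> ~ I E -> S !=set0.
Proof.
move=> [_ full] nIE; apply/set0P/eqP => S0; apply: nIE; rewrite -[E]setD0.
apply: full; first exact/negligible_measurable/negligible0.
by rewrite S0.
Qed.

Lemma completely_nonmeasurableP S E :
  completely_nonmeasurable A I S E <->
  full_subset A I S E /\ full_subset A I (E `\` S) E.
Proof.
split=> [[SE cnm]|[/full_subsetP[SE fullS] /full_subsetP[_ fullD]]].
  split; apply/full_subsetP; split=> //; try exact: subDsetl.
    by move=> B AB IBS; apply: contrapT => /(cnm _ AB)[].
  by move=> B AB IBD; apply: contrapT => /(cnm _ AB)[].
by split=> // B AB nIBE; split=> [/fullS|/fullD] => /(_ AB).
Qed.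

Lemma disjoint_full_completely_nonmeasurable S S' E :
  full_subset A I S E -> full_subset A I S' E -> S `&` S' = set0 ->
  completely_nonmeasurable A I S E.
Proof.
move=> fullS fullS' SS'0; apply/completely_nonmeasurableP; split=> //.
have [S'E _] := fullS'; apply: full_subsetS fullS'; last exact: subDsetl.
by rewrite setDE subsetI; split=> //; apply/disjoints_subset; rewrite setIC.
Qed.

Lemma disjoint_full_halvable E F G :
  full_subset A I F E -> full_subset A I G E -> F `&` G = set0 ->
  full_halvable A I E.
Proof.
move=> fullF fullG FG0; exists F; apply/completely_nonmeasurableP.
exact: disjoint_full_completely_nonmeasurable fullG FG0.
Qed.

Lemma full_subset_halvable S E :
  full_subset A I S E -> full_halvable A I S -> full_halvable A I E.
Proof.
move=> fullS [F [fullF fullSF]]; apply: (@disjoint_full_halvable _ F (S `\` F)).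
- exact: full_subset_trans fullS.
- exact: full_subset_trans fullS.
- exact: setDIK.
Qed.

Lemma full_halvable_bigcup {T : Type} (D : set T) (E : T -> set X) :
  countable D -> trivIset D E -> (forall i, D i -> full_halvable A I (E i)) ->
  full_halvable A I (\bigcup_(i in D) E i).
Proof.
move=> cD tE halvE.
have /choice[h full_h] : forall i, exists S, D i ->
    full_subset A I S (E i) /\ full_subset A I (E i `\` S) (E i).
  move=> i; have [Di|nDi] := pselect (D i); last by exists set0.
  by have [S fullS] := halvE i Di; exists S.
apply: (@disjoint_full_halvable _ (\bigcup_(i in D) h i)
                                  (\bigcup_(i in D) (E i `\` h i))).
- by apply: full_subset_bigcup => // i /full_h[].
- by apply: full_subset_bigcup => // i /full_h[].
- rewrite -subset0 => x [[i Di hix] [j Dj [Ejx nhjx]]]; apply: nhjx.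
  have [[hE _] _] := full_h i Di.
  by have <- : i = j by apply: tE => //; exists x; split=> //; exact: hE.
Qed.

Section IteratedHalving.
Hypothesis halvable : forall E, full_halvable A I E.

Lemma disjoint_full_sequence E :
  exists T : nat -> set X,
    trivIset setT T /\ forall n, full_subset A I (T n) E.
Proof.
have [h full_h] := choice halvable.
pose Q n := iter n (fun S => S `\` h S) E.
have fullQ n : full_subset A I (Q n) E.
  elim: n => [|n]; first exact: full_subset_refl.
  by apply: full_subset_trans; have [] := full_h (Q n).
have Q_avoids m n : (m < n)%N -> Q n `<=` ~` h (Q m).
  elim: n => // n IHn; rewrite ltnS leq_eqVlt => /predU1P[->|/IHn QnC].
    by move=> x [].
  by move=> x [/QnC].
exists (h \o Q); split=> [|n]; last first.
  by apply: full_subset_trans (fullQ n); have [] := full_h (Q n).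
apply: ltn_trivIset => n m mn /=; rewrite setIC; apply/disjoints_subset.
by have [[hQ _] _] := full_h (Q n); apply: subset_trans hQ (Q_avoids _ _ mn).
Qed.

Lemma full_infinite_decomposition E : infinite_set E ->
  exists F : set (set X), infinite_decomposition E F /\
    forall S, F S -> full_subset A I S E.
Proof.
move=> infE.
suff [k fiber_neq0 full_fiber] : exists2 k : X -> nat,
    forall n, E `&` k @^-1` [set n] !=set0 &
    forall n, full_subset A I (E `&` k @^-1` [set n]) E.
  exists (range (fun n => E `&` k @^-1` [set n])).
  by split=> [|_ [n _ <-]]; [exact: infinite_decomposition_fibers|].
have [IE|nIE] := pselect (I E).
  have [k fiber_neq0] := infinite_set_fibers infE; exists k => // n.
  apply: (full_subset_mod_negligible I_ideal); first exact: subIsetl.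
  by apply: (sub_negligible I_ideal) IE; exact: subDsetl.
have [T [tT fullT]] := disjoint_full_sequence E.
have [k Tk] := trivIset_sub_fibers tT.
have full_fiber n : full_subset A I (E `&` k @^-1` [set n]) E.
  apply: full_subsetS (fullT n); last exact: subIsetl.
  by rewrite subsetI; split=> //; have [] := fullT n.
by exists k => // n; exact: full_subset_neq0 nIE.
Qed.

End IteratedHalving.

Lemma separated_mod_negligible F G H :
  F `&` G = set0 -> A H -> F `<=` H -> I (H `&` G) -> separated_by A F G.
Proof.
move=> /disjoints_subset FG AH FH IHG; exists (H `\` G); split.
- exact: setD_mod_negligible_measurable.
- by rewrite setDE subsetI.
- exact: setDKI.
Qed.

Section CountableChainCondition.
Hypothesis AI_ccc : countable_chain_condition (A `\` I).

Lemma ccc_exhaustion (P : set (set X)) :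
  exists D : set (set X), [/\ countable D, D `<=` A `&` P, trivIset D id &
    forall C, A C -> P C -> C `&` \bigcup_(S in D) S = set0 -> I C].
Proof.
have [D [DAP tD maxD]] :=
  @ex_maximal_disjoint_subcollection (set X) X id ((A `\` I) `&` P).
exists D; split=> //.
- by apply: AI_ccc => // S /DAP[].
- by move=> S /DAP[[AS _] PS].
move=> C AC PC CD0; apply: contrapT => nIC.
have disjC S : D S -> ~ (C `&` S !=set0).
  move=> DS [x [Cx Sx]]; rewrite -[False]/(set0 x) -CD0.
  by split=> //; exists S.
apply: (maxD (D `|` [set C])).
- split=> [|/(_ C (or_intror erefl)) DC]; first exact: subsetUl.
  apply/nIC/(sub_negligible I_ideal _ (negligible0 I_ideal)) => x Cx.
  by apply: (disjC _ DC); exists x.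
- by move=> S [/DAP//|->].
- move=> S S' [DS|->] [DS'|->] //; first exact: tD.
  + by rewrite setIC => /(disjC _ DS).
  + by move/(disjC _ DS').
Qed.

Lemma measurable_hull F : exists H, A H /\ full_subset A I F H.
Proof.
have [D [cD DAP _ maxD]] := ccc_exhaustion [set C | I (C `&` F)].
pose U := \bigcup_(S in D) S; pose H := ~` (U `\` F).
have AU : A U by apply: sigma_algebra_countable_bigcup => // S /DAP[].
have IUF : I (U `&` F).
  by rewrite setI_bigcupl; apply: negligible_bigcup => // S /DAP[].
have AH : A H.
  exact/(sigma_algebra_setC A_sigma)/setD_mod_negligible_measurable.
exists H; split=> //; split=> [x Fx []//|B AB FB].
apply: maxD => /=; first exact: sigma_algebra_setD.
- suff -> : (H `\` B) `&` F = set0 by exact: negligible0.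
  by rewrite -subset0 => x [[_ nBx] /FB].
- by rewrite -subset0 => x [[nUF nBx] Ux]; apply: nUF; split=> // /FB.
Qed.

Lemma not_separated_common_hull F G :
  F `&` G = set0 -> ~ separated_by A F G ->
  exists M, [/\ A M, ~ I M,
    full_subset A I (F `&` M) M & full_subset A I (G `&` M) M].
Proof.
move=> FG0 nsep.
have [HF [AHF fullF]] := measurable_hull F.
have [HG [AHG fullG]] := measurable_hull G.
have AM : A (HF `&` HG) by exact: sigma_algebra_setI.
exists (HF `&` HG); split=> //.
- move=> IM; apply: nsep; have [FHF _] := fullF; have [GHG _] := fullG.
  apply: (separated_mod_negligible FG0 AHF FHF).
  by apply: (sub_negligible I_ideal) IM; exact: setIS.
- have := full_subset_setIr AM fullF.
  by rewrite [HF `&` (_ `&` _)]setIA setIid.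
- have := full_subset_setIr AM fullG.
  by rewrite [HG `&` (_ `&` _)]setICA setIid.
Qed.

Hypothesis AI_nonsep : non_separation_property A I.

Lemma ex_full_halvable_piece E : ~ I E ->
  exists M, [/\ A M, ~ I (E `&` M) & full_halvable A I (E `&` M)].
Proof.
move=> /AI_nonsep[F [G [FE GE FG0 nsep]]].
have [M [AM nIM fullF fullG]] := not_separated_common_hull FG0 nsep.
exists M; split=> //.
- move=> IEM; apply: nIM; rewrite -[M]setIid.
  have /full_subsetP[_ full] := fullF; apply: full => //.
  by apply: (sub_negligible I_ideal) IEM; rewrite setICA setIid; exact: setSI.
- apply: (@disjoint_full_halvable _ (F `&` M) (G `&` M)).
  + exact: (full_subset_sub I_ideal) (setSI FE) (@subIsetr _ _ _) fullF.
  + exact: (full_subset_sub I_ideal) (setSI GE) (@subIsetr _ _ _) fullG.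
  + by rewrite setIACA FG0 set0I.
Qed.

Lemma ccc_nonsep_full_halvable E : full_halvable A I E.
Proof.
have [D [cD DAP tD maxD]] :=
  ccc_exhaustion [set C | full_halvable A I (E `&` C)].
pose U := \bigcup_(S in D) S.
have AU : A U by apply: sigma_algebra_countable_bigcup => // S /DAP[].
have IR : I (E `\` U).
  apply: contrapT => /ex_full_halvable_piece[M [AM nIR halvR]].
  have ER : E `&` (M `\` U) = (E `\` U) `&` M by rewrite setIDAC.
  apply: nIR; rewrite -ER; apply: (sub_negligible I_ideal) (@subIsetr _ _ _) _.
  apply: maxD => /=; [exact: sigma_algebra_setD|by rewrite ER|exact: setDKI].
apply: (@full_subset_halvable (E `&` U)).
  apply: (full_subset_mod_negligible I_ideal); first exact: subIsetl.
  by rewrite setDIr setDv set0U.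
rewrite setI_bigcupr; apply: full_halvable_bigcup => //.
- exact: trivIset_setIl.
- by move=> S /DAP[].
Qed.

End CountableChainCondition.
End Triple.

Theorem theorem2p4 (X : Type) (A I : set (set X))
  (hT : measurable_triple A I)
  (hccc : countable_chain_condition (A `\` I))
  (hns : non_separation_property A I)
  (E : set X) (hE : infinite_set E) :
  [/\ exists E1 E2 : set X,
        [/\ E = E1 `|` E2, E1 `&` E2 = set0,
            full_subset A I E1 E & full_subset A I E2 E],
      exists F : set (set X),
        infinite_decomposition E F /\
        (forall S : set X, F S -> full_subset A I S E) &
      forall F : set (set X), infinite_decomposition E F ->
        ((forall S : set X, F S -> full_subset A I S E) <->
         (forall S : set X, F S -> completely_nonmeasurable A I S E))].
Proof.
have halvable := ccc_nonsep_full_halvable hT hccc hns.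
split; last move=> F [infF tF _].
- have [E1 [fullE1 fullE2]] := halvable E.
  exists E1, (E `\` E1); split=> //; last exact: setDIK.
  by rewrite setDUK //; case: fullE1.
- exact: full_infinite_decomposition hT halvable E hE.
- split=> hF S FS; last by have /(completely_nonmeasurableP hT)[] := hF S FS.
  have [S' [FS' S'S]] : (F `\` [set S]) !=set0.
    by apply/infinite_setN0/infinite_setD.
  apply: (disjoint_full_completely_nonmeasurable hT (hF _ FS) (hF _ FS')).
  apply: contrapT => /eqP/set0P/(tF _ _ FS FS') SS'.
  by apply: S'S; rewrite SS'.
Qed.
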